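(* Let $P$ be a family of transition probabilities on $A\times\underline{A}$ and $(\gamma_m)_{m\ge0}$ a real sequence decreasing monotonically to $0$ with $\gamma_0<1$, such that for every $a\in A$ and $m\ge0$, $$\inf_{x,y\,:\,x\stackrel{m}{=}y}\frac{P(a\mid x)}{P(a\mid y)}\;\ge\;1-\gamma_m .$$ For each history $x$ let $(Z^x_n)_{n\in\mathbb{Z}}$ be the chain with past $x$ and transitions $P$. Then for all histories $x,y\in\underline{A}$, all $a\in A$ and all $n\ge0$, $$\big|\mathbf{P}(Z^x_n=a)-\mathbf{P}(Z^y_n=a)\big|\le\gamma^*_n ,$$ and, for all $k\ge1$, all $n\ge k$ and all $(a_0,\dots,a_k)\in A^{k+1}$, $$\Big|\mathbf{P}\big((Z^x_n,\dots,Z^x_{n+k})=(a_0,\dots,a_k)\big)-\mathbf{P}\big((Z^y_n,\dots,Z^y_{n+k})=(a_0,\dots,a_k)\big)\Big|\;\le\;\sum_{j=0}^k\left(\prod_{m=1}^{j-1}(1-\gamma_m)\right)\gamma^*_{n-j},$$ where empty products equal $1$.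
   Context: $A$ is a finite set and $\underline{A}=\{x=(x_j)_{j\le-1}:x_j\in A\}$ is the set of histories, with the product topology and $\sigma$-algebra. For $x,y\in\underline{A}$ and $m\ge0$, $x\stackrel{m}{=}y$ means $x_j=y_j$ for all $-m\le j\le-1$ (no condition if $m=0$). A family of transition probabilities on $A\times\underline{A}$ is a map $P:A\times\underline{A}\to[0,1]$, $(a,z)\mapsto P(a\mid z)$, with $\sum_{a\in A}P(a\mid z)=1$ for every $z$. The ratio condition is understood as $P(a\mid x)\ge(1-\gamma_m)P(a\mid y)$ whenever $x\stackrel{m}{=}y$. For $x\in\underline{A}$, the chain with past $x$ and transitions $P$ is the process $(Z^x_n)_{n\in\mathbb{Z}}$ with $Z^x_n=x_n$ for $n\le-1$ and, for $n\ge0$, $\mathbf{P}(Z^x_n=a\mid Z^x_{n+j}=z_j,\ j\le-1)=P(a\mid z)$ for all $a\in A$ and all histories $z$ with $z_{j-n}=x_j$, $j\le-1$. $(S^{(\gamma)}_n)_{n\ge0}$ is the Markov chain on $\{0,1,2,\dots\}$ with $S^{(\gamma)}_0=0$ almost surely and transition probabilities $p_{i,i+1}=1-\gamma_i$, $p_{i,0}=\gamma_i$ for all $i\ge0$; $\gamma^*_n=\mathbf{P}(S^{(\gamma)}_n=0)$ for $n\ge0$ (so $\gamma^*_0=1$). *)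

(* Defs.v *)
From HB Require Import structures.
From mathcomp Require Import all_boot all_order all_algebra.
From mathcomp Require Import all_classical all_reals all_analysis.

Set Implicit Arguments.
Unset Strict Implicit.
Unset Printing Implicit Defensive.

Import Order.TTheory GRing.Theory Num.Theory.
Import numFieldNormedType.Exports.

Local Open Scope classical_set_scope.
Local Open Scope ring_scope.

(* A history (x_j)_{j <= -1} is stored as i |-> x_{-(i+1)}, so that the entry
   [x i] sits at the integer time [Negz i]. *)
Definition history (A : Type) : Type := nat -> A.

(* Times -m, ..., -1 are the indices i < m. *)
Definition agree (A : Type) (m : nat) (x y : history A) : Prop :=
  forall i : nat, (i < m)%N -> x i = y i.

Definition transition_probabilities (R : realType) (A : finType)
    (p : A -> history A -> R) : Prop :=
  (forall a z, 0 <= p a z <= 1) /\ (forall z, \sum_(a : A) p a z = 1).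

(* inf p(a|x) / p(a|y) >= 1 - gamma_m, with the quotient cleared. *)
Definition ratio_condition (R : realType) (A : finType)
    (p : A -> history A -> R) (gamma : nat -> R) : Prop :=
  forall (a : A) (m : nat) (x y : history A),
    agree m x y -> (1 - gamma m) * p a y <= p a x.

Section Processes.
Context {R : realType} {d : measure_display} {Omega : measurableType d}.
Variable Pr : probability Omega R.

Definition prob (E : set Omega) : R := fine (Pr E).

(* Only meaningful when [0 < prob F]; every use below is so guarded. *)
Definition cond_prob (E F : set Omega) : R := prob (E `&` F) / prob F.

(* Random variable with values in a countable set carrying all its subsets. *)
Definition discrete_rv (T : Type) (X : Omega -> T) : Prop :=
  forall t : T, measurable [set w | X w = t].

(* In [chain_law], the conditioning event {Z_(n+j) = z_j for all j <= -1}
   reads off j = -(i+1), and the constraint z_(j-n) = x_j becomes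
   z (n + i) = x i. *)
Record chain_with_past (A : finType) (p : A -> history A -> R) (x : history A)
    (Z : int -> Omega -> A) : Prop := {
  chain_rv : forall n : int, discrete_rv (Z n);
  chain_past : {ae Pr, forall w, forall i : nat, Z (Negz i) w = x i};
  chain_law : forall (n : nat) (a : A) (z : history A),
    (forall i : nat, z (n + i)%N = x i) ->
    let past := [set w | forall i : nat, Z (n%:Z - i.+1%:Z) w = z i] in
    0 < prob past -> cond_prob [set w | Z n%:Z w = a] past = p a z }.

Record markov_chain (q : nat -> nat -> R) (s0 : nat)
    (S : nat -> Omega -> nat) : Prop := {
  markov_rv : forall n : nat, discrete_rv (S n);
  markov_init : {ae Pr, forall w, S 0%N w = s0};
  markov_law : forall (n : nat) (s : nat -> nat) (t : nat),
    let past := [set w | forall i : nat, (i <= n)%N -> S i w = s i] in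
    0 < prob past -> cond_prob [set w | S n.+1 w = t] past = q (s n) t }.

End Processes.

Definition house_of_cards (R : realType) (gamma : nat -> R) (i t : nat) : R :=
  if t == i.+1 then 1 - gamma i else if t == 0%N then gamma i else 0.

(* Main.v *)
Require Import Defs.
From HB Require Import structures.
From mathcomp Require Import all_boot all_order all_algebra.
From mathcomp Require Import all_classical all_reals all_analysis.
From mathcomp Require Import zify ring lra.

Set Implicit Arguments.
Unset Strict Implicit.
Unset Printing Implicit Defensive.

Import Order.TTheory GRing.Theory Num.Theory.
Import numFieldNormedType.Exports.

Local Open Scope classical_set_scope.
Local Open Scope ring_scope.

(** Let [step] and [hoc_step] be the one-step transfer operators
  [F |-> E (F (z extended by the next symbol))] and [u |-> E_i (u S_1)] of the
  chain and of the house-of-cards chain.  Splitting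
  [p(.|x) = (1 - gamma_m) p(.|y) + q] when [x] and [y] agree on [m] symbols
  shows that a modulus of continuity [u] of [F], in terms of the number of
  agreeing symbols, is transported to the modulus [hoc_step u] of [step F]: this
  is the paper's coupling with the number of agreements dominating [S], read on
  functions.  A block of [k+1] symbols has modulus [1_{i <= k}], so that the
  probabilities of the block at times [n, ..., n+k] differ by at most
  [P(S_{n+k+1} <= k)
     = \sum_(j <= k) \prod_(0 <= m < j) (1 - gamma_m) gamma*_(n+k+1-j)],
  which is below the stated bound because [gamma*] is nonincreasing. *)

Definition extend (A : Type) (a : A) (z : history A) : history A :=
  fun i => if i is j.+1 then z j else a.

(** * Transfer operators and moduli of continuity *)

Section TransferOperators.
Context {R : realType} {A : finType}.
Variables (p : A -> history A -> R) (gamma : nat -> R).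

Definition step (F : history A -> R) (z : history A) : R :=
  \sum_(a : A) p a z * F (extend a z).

Definition hoc_step (u : nat -> R) (i : nat) : R :=
  (1 - gamma i) * u i.+1 + gamma i * u 0%N.

(** A one-sided bound suffices, since [agree m] is symmetric. *)
Definition oscillation_le (F : history A -> R) (u : nat -> R) : Prop :=
  forall m x y, agree m x y -> F x - F y <= u m.

Lemma agree_extend m (x y : history A) a :
  agree m x y -> agree m.+1 (extend a x) (extend a y).
Proof. by move=> xy [|i] //= im; apply: xy. Qed.

Hypotheses (gamma_le1 : forall m, gamma m <= 1)
  (p_trans : transition_probabilities p)
  (p_ratio : ratio_condition p gamma).

Lemma oscillation_le_step F u :
  oscillation_le F u -> oscillation_le (step F) (hoc_step u).
Proof.
move=> Fu m x y xy; have [p01 p1] := p_trans.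
pose q a := p a x - (1 - gamma m) * p a y.
have q0 a : 0 <= q a by rewrite subr_ge0; apply: p_ratio.
have qs : \sum_a q a = gamma m.
  rewrite /q sumrB -mulr_sumr !p1; lra.
(* The worst case, for the leftover mass [q]: [agree 0] is vacuous, so any two values of [F] differ
   by at most [u 0], and averaging over [b] with weights [p b y] gives the bound. *)
have FyE a : F (extend a x) <= step F y + u 0%N.
  have -> : F (extend a x) = \sum_b p b y * F (extend a x).
    by rewrite -mulr_suml p1 mul1r.
  have -> : u 0%N = \sum_b p b y * u 0%N by rewrite -mulr_suml p1 mul1r.
  rewrite -big_split /=; apply: ler_sum => b _; rewrite -mulrDr.
  apply: ler_wpM2l; first by case/andP: (p01 b y).
  by rewrite addrC -lerBlDr; apply: Fu.
have -> : step F x = \sum_a q a * F (extend a x)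
    + (1 - gamma m) * \sum_a p a y * F (extend a x).
  rewrite mulr_sumr -big_split /=; apply: eq_bigr => a _.
  rewrite /q; ring.
have le1 : \sum_a q a * F (extend a x) <= gamma m * (step F y + u 0%N).
  by rewrite -qs mulr_suml; apply: ler_sum => a _; apply: ler_wpM2l.
have le2 : (1 - gamma m) * \sum_a p a y * F (extend a x)
    <= (1 - gamma m) * (step F y + u m.+1).
  have -> : u m.+1 = \sum_b p b y * u m.+1 by rewrite -mulr_suml p1 mul1r.
  rewrite /step -big_split /= !mulr_sumr; apply: ler_sum => a _.
  rewrite -mulrDr !mulrA; apply: ler_wpM2l.
    have /andP[pay _] := p01 a y.
    by rewrite mulr_ge0 // subr_ge0.
  by rewrite addrC -lerBlDr; apply: Fu; apply: agree_extend.
rewrite /hoc_step; lra.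
Qed.

Lemma oscillation_le_iter_step F u n :
  oscillation_le F u -> oscillation_le (iter n step F) (iter n hoc_step u).
Proof. by move=> Fu; elim: n => //= n; apply: oscillation_le_step. Qed.

End TransferOperators.

(** * Real-valued probabilities of events *)

Section Probability.
Context {R : realType} {d : measure_display} {Omega : measurableType d}.
Variable Pr : probability Omega R.
Implicit Types E F : set Omega.

Lemma probE E : measurable E -> (prob Pr E)%:E = Pr E.
Proof. by move=> mE; rewrite fineK // fin_num_measure. Qed.

Lemma prob_ge0 E : 0 <= prob Pr E.
Proof. exact: fine_ge0. Qed.

Lemma prob_le E F : measurable E -> measurable F -> E `<=` F ->
  prob Pr E <= prob Pr F.
Proof.
by move=> mE mF EF; rewrite -lee_fin !probE // le_measure ?inE.
Qed.

Lemma prob_ae E : measurable E -> {ae Pr, forall w, E w} -> prob Pr E = 1.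
Proof.
move=> mE aeE; apply: EFin_inj; rewrite probE //.
have := probability_setC Pr (measurableC mE); rewrite setCK => ->.
by rewrite (measure_negligible (measurableC mE)) ?sube0.
Qed.

Lemma prob_setIC E F : measurable E -> measurable F ->
  prob Pr E = prob Pr (E `&` F) + prob Pr (E `\` F).
Proof.
move=> mE mF; apply: EFin_inj; rewrite EFinD !probE //.
- by rewrite addeC; apply: measureDI.
- exact: measurableD.
- exact: measurableI.
Qed.

Lemma prob_setI1 E F : measurable E -> measurable F ->
  prob Pr F = 1 -> prob Pr (E `&` F) = prob Pr E.
Proof.
move=> mE mF F1; rewrite (prob_setIC mE mF) -[LHS]addr0; congr (_ + _).
apply/esym/eqP; rewrite eq_le prob_ge0 andbT.
have <- : prob Pr (~` F) = 0.
  have := prob_setIC measurableT mF.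
  by rewrite setTI setTD F1 {1}/prob probability_setT /=; lra.
apply: prob_le; [exact: measurableD|exact: measurableC|by move=> w []].
Qed.

Lemma prob_partition (A : finType) (X : Omega -> A) E :
  measurable E -> discrete_rv X ->
  prob Pr E = \sum_(a : A) prob Pr (E `&` [set w | X w = a]).
Proof.
move=> mE mX; have mEX a : measurable (E `&` [set w | X w = a]).
  exact: measurableI.
apply: EFin_inj; rewrite -sumEFin probE //.
under eq_bigr => a _ do rewrite probE //.
rewrite fsbig_seq ?index_enum_uniq //= -measure_fin_bigcup //.
- congr (Pr _); apply/seteqP; split => w /=.
    by move=> Ew; exists (X w) => //=; rewrite mem_index_enum.
  by case=> a _ [].
- by move=> a b _ _ [w [[_ /= <-] [_ /= <-]]].
Qed.

(** The product form removes the positivity guard: if [F] is null, both sides vanish. *)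
Lemma cond_probM E F (c : R) : measurable E -> measurable F ->
  (0 < prob Pr F -> cond_prob Pr E F = c) ->
  prob Pr (F `&` E) = prob Pr F * c.
Proof.
move=> mE mF Ec; have [F0|F0] := ltP 0 (prob Pr F).
  by rewrite -(Ec F0) /cond_prob mulrC divfK ?gt_eqF // setIC.
have -> : prob Pr F = 0 by apply/eqP; rewrite eq_le F0 prob_ge0.
rewrite mul0r; apply/eqP; rewrite eq_le prob_ge0 andbT.
by apply: le_trans F0; apply: prob_le => //; apply: measurableI.
Qed.

End Probability.

(** * The law of the chain in terms of [step] *)

Section Cylinders.
Context {R : realType} {d : measure_display} {Omega : measurableType d}.
Variables (Pr : probability Omega R) (A : finType).
Variables (p : A -> history A -> R) (x : history A) (Z : int -> Omega -> A).
Hypothesis Z_chain : chain_with_past Pr p x Z.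

Definition history_at (n : nat) (w : Omega) : history A :=
  fun i => Z (n%:Z - i.+1%:Z) w.

Definition cylinder (n : nat) (z : history A) : set Omega :=
  [set w | forall i, history_at n w i = z i].

Lemma measurable_cylinder n z : measurable (cylinder n z).
Proof.
have -> : cylinder n z = \bigcap_i [set w | Z (n%:Z - i.+1%:Z) w = z i].
  by apply/seteqP; split=> w /= H i; [move=> _|]; apply: H.
by apply: bigcapT_measurable => i; apply: (chain_rv Z_chain).
Qed.

Lemma history_atS n w : history_at n.+1 w = extend (Z n%:Z w) (history_at n w).
Proof.
by apply/funext => -[|i]; rewrite /history_at /=; congr (Z _ w); lia.
Qed.

Lemma cylinderS n a z :
  cylinder n.+1 (extend a z) = cylinder n z `&` [set w | Z n%:Z w = a].
Proof.
apply/seteqP; split => w; rewrite /cylinder /= history_atS.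
  by move=> H; split=> [i|]; [apply: (H i.+1)|apply: (H 0%N)].
by case=> H <- [|i] //=.
Qed.

(* Backward induction on [n], at the fixed final time [n + k]. *)
Lemma prob_cylinder_history_at (D : set (history A)) k n z :
  measurable [set w | D (history_at (n + k) w)] ->
  (forall i, z (n + i)%N = x i) ->
  prob Pr (cylinder n z `&` [set w | D (history_at (n + k) w)]) =
  prob Pr (cylinder n z) * iter k (step p) \1_D z.
Proof.
elim: k n z => [|k IH] n z.
  rewrite addn0 => mD _ /=; rewrite indicE.
  have hz w : cylinder n z w -> history_at n w = z by move=> h; apply/funext.
  case: (pselect (D z)) => Dz.
    rewrite mem_set // mulr1; congr prob; apply/seteqP; split => w /=.
      by case.
    by move=> cw; split=> //; rewrite hz.
  rewrite memNset // mulr0 (_ : _ `&` _ = set0) ?/prob ?measure0 //.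
  by apply/seteqP; split => w //= [/hz ->].
rewrite -addSnnS => mD zx.
have mc := measurable_cylinder; have mZ := chain_rv Z_chain n%:Z.
rewrite (prob_partition Pr (measurableI _ _ (mc n z) mD) mZ).
rewrite iterS {1}/step mulr_sumr; apply: eq_bigr => a _.
(* Prescribing the symbol at time [n] turns the cylinder of [z] into that of [extend a z], which
   still continues [x], one index further. *)
rewrite setIAC -cylinderS IH ?addSn //.
rewrite cylinderS (cond_probM (mZ a) (mc n z) (c := p a z)) ?mulrA //.
exact: (chain_law Z_chain a zx).
Qed.

(** The cylinder of [x] at time 0 has probability one, so intersecting with it changes nothing. *)
Lemma prob_history_at (D : set (history A)) n :
  measurable [set w | D (history_at n w)] ->
  prob Pr [set w | D (history_at n w)] = iter n (step p) \1_D x.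
Proof.
move=> mD; have mc := measurable_cylinder 0 x.
have c1 : prob Pr (cylinder 0 x) = 1.
  apply: prob_ae => //; have := chain_past Z_chain; apply: filterS => w H i.
  by rewrite -H /history_at sub0r NegzE.
have := @prob_cylinder_history_at D n 0%N x mD (fun=> erefl).
by rewrite c1 mul1r => <-; rewrite add0n setIC prob_setI1.
Qed.

End Cylinders.

(** * The law of the house-of-cards chain in terms of [hoc_step] *)

Section HouseOfCards.
Context {R : realType} {d : measure_display} {Omega : measurableType d}.
Variables (Pr : probability Omega R) (gamma : nat -> R).
Variable S : nat -> Omega -> nat.
Hypothesis S_markov : markov_chain Pr (house_of_cards gamma) 0%N S.

Definition path_event (n : nat) (s : nat -> nat) : set Omega :=
  [set w | forall i : nat, (i <= n)%N -> S i w = s i].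

Lemma measurable_path_event n s : measurable (path_event n s).
Proof.
have -> : path_event n s =
    \bigcap_i (if (i <= n)%N then [set w | S i w = s i] else setT).
  apply/seteqP; split=> w /= H i; first by move=> _; case: ifPn => //= /H.
  by move=> i_n; have := H i I; rewrite i_n.
apply: bigcapT_measurable => i; case: ifP => // _.
exact: (markov_rv S_markov).
Qed.

Lemma path_eventS n s t :
  path_event n s `&` [set w | S n.+1 w = t] =
  path_event n.+1 (fun i => if (i <= n)%N then s i else t).
Proof.
apply/seteqP; split => w /=.
  case=> H <- i; rewrite leq_eqVlt ltnS => /predU1P[->|i_n]; first by rewrite ltnn.
  by rewrite i_n H.
move=> H; split=> [i i_n|]; last by rewrite H // ltnn.
by rewrite H ?i_n // leqW.
Qed.

(** Backward induction again. The state space is infinite, so the next state is split into three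
    cases only: [0], [(s n).+1], and a null remainder. *)
Lemma prob_path_event_at (D : set nat) k n s :
  measurable [set w | D (S (n + k) w)] ->
  prob Pr (path_event n s `&` [set w | D (S (n + k) w)]) =
  prob Pr (path_event n s) * iter k (hoc_step gamma) \1_D (s n).
Proof.
elim: k n s => [|k IH] n s.
  rewrite addn0 => mD /=; rewrite indicE.
  case: (pselect (D (s n))) => Dz.
    rewrite mem_set // mulr1; congr prob; apply/seteqP; split => w /=.
      by case.
    by move=> cw; split=> //; rewrite cw.
  rewrite memNset // mulr0 (_ : _ `&` _ = set0) ?/prob ?measure0 //.
  by apply/seteqP; split => w //= [-> ].
rewrite -addSnnS => mD.
have mC : measurable (path_event n s) := measurable_path_event n s.
set C := path_event n s in mC *; set B := [set w | D _] in mD *.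
pose F t := [set w | S n.+1 w = t].
have mF t : measurable (F t) by apply: (markov_rv S_markov).
have CF t : prob Pr (C `&` F t) = prob Pr C * house_of_cards gamma (s n) t.
  by apply: cond_probM => //; apply: (markov_law S_markov).
have CBF t : prob Pr (C `&` B `&` F t) = prob Pr (C `&` F t)
    * iter k (hoc_step gamma) \1_D t.
  by rewrite setIAC path_eventS IH // ltnn.
have F01 E : (E `\` F 0%N) `&` F (s n).+1 = E `&` F (s n).+1.
  apply/seteqP; split=> w /=; first by case=> -[].
  by case=> Ew Fw; do 2?split=> //; rewrite /F /= Fw.
have split2 E : measurable E -> prob Pr E = prob Pr (E `&` F 0%N)
    + prob Pr (E `&` F (s n).+1) + prob Pr (E `\` F 0%N `\` F (s n).+1).
  move=> mE; rewrite (prob_setIC Pr mE (mF 0%N)) -addrA; congr (_ + _).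
  by rewrite (prob_setIC Pr (measurableD mE (mF 0%N)) (mF (s n).+1)) F01.
(* The weights [gamma (s n)] and [1 - gamma (s n)] already exhaust the mass of [C]. *)
have rest0 : prob Pr (C `\` F 0%N `\` F (s n).+1) = 0.
  have := split2 _ mC; rewrite !CF /house_of_cards !eqxx /=; lra.
have restB0 : prob Pr ((C `&` B) `\` F 0%N `\` F (s n).+1) = 0.
  apply/eqP; rewrite eq_le prob_ge0 andbT -rest0; apply: prob_le.
  - by do 2?apply: measurableD => //; apply: measurableI.
  - by do 2?apply: measurableD.
  - by apply: setSD; apply: setSD => w [].
rewrite (split2 _ (measurableI _ _ mC mD)) restB0 addr0 !CBF !CF.
rewrite /house_of_cards !eqxx /= [hoc_step gamma _ _]/hoc_step; ring.
Qed.

Lemma prob_markov_at (D : set nat) n :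
  prob Pr [set w | D (S n w)] = iter n (hoc_step gamma) \1_D 0%N.
Proof.
have mD : measurable [set w | D (S n w)].
  have -> : [set w | D (S n w)] = \bigcup_(t in D) [set w | S n w = t].
    by apply/seteqP; split=> w /= => [Dw|[t Dt ->] //]; exists (S n w).
  by apply: bigcup_measurable => t _; apply: (markov_rv S_markov).
pose s0 (i : nat) := 0%N; have mc := measurable_path_event 0 s0.
have c1 : prob Pr (path_event 0 s0) = 1.
  apply: prob_ae => //; have := markov_init S_markov; apply: filterS => w H i.
  by rewrite leqn0 => /eqP ->.
have := @prob_path_event_at D n 0%N s0 mD.
by rewrite c1 mul1r => <-; rewrite add0n setIC prob_setI1.
Qed.

End HouseOfCards.

(** * Return probabilities of the house-of-cards chain *)

Section ReturnProbabilities.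
Context {R : realType}.
Variable gamma : nat -> R.
Local Notation Q := (hoc_step gamma).

Lemma iter_hoc_step_linear n (c : R) (u v : nat -> R) :
  iter n Q (fun i => c * u i + v i) = fun i => c * iter n Q u i + iter n Q v i.
Proof.
elim: n => //= n ->; apply/funext => i; rewrite /hoc_step; ring.
Qed.

Lemma indic_set1 (i j : nat) : \1_[set j] i = (i == j)%:R :> R.
Proof. by rewrite indicE; congr ((nat_of_bool _)%:R); apply/idP/eqP; rewrite inE. Qed.

Lemma indic_itv (i k : nat) : \1_(`I_k) i = (i < k)%:R :> R.
Proof. by rewrite indicE; congr ((nat_of_bool _)%:R); apply/idP/idP; rewrite inE. Qed.

(** Height [j] is reached only by being at 0 exactly [j] steps earlier and then climbing without a
    reset. *)
Lemma iter_hoc_step_set1 n j :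
  iter (n + j) Q \1_[set j] 0%N =
  \prod_(0 <= m < j) (1 - gamma m) * iter n Q \1_[set 0%N] 0%N.
Proof.
elim: j => [|j IH]; first by rewrite big_geq // mul1r addn0.
(* The added zero gives the shape expected by [iter_hoc_step_linear]. *)
have QE : Q \1_[set j.+1] = fun i => (1 - gamma j) * \1_[set j] i + 0%R.
  apply/funext => i; rewrite /hoc_step !indic_set1 eqSS /=.
  by case: eqVneq => [->|_] /=; ring.
have iter0 m : iter m Q (fun=> 0) = fun=> 0.
  elim: m => //= m ->; apply/funext => i; rewrite /hoc_step; ring.
rewrite addnS iterSr QE iter_hoc_step_linear iter0 IH big_nat_recr //=; ring.
Qed.

Lemma iter_hoc_step_itv n k :
  iter n Q \1_(`I_k.+1) 0%N = \sum_(j < k.+1) iter n Q \1_[set nat_of_ord j] 0%N.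
Proof.
elim: k => [|k IH].
  by rewrite big_ord_recl big_ord0 addr0 /= II1.
have -> : \1_(`I_k.+2) = fun i => 1 * \1_(`I_k.+1) i + \1_[set k.+1] i :> R.
  apply/funext => i; rewrite !indic_itv indic_set1 [(i < k.+2)%N]ltnS (leq_eqVlt i).
  case: eqVneq => [->|_] /=; rewrite ?ltnn ?mulr0n; ring.
by rewrite iter_hoc_step_linear mul1r IH [RHS]big_ord_recr.
Qed.

Hypotheses (gamma_mono : nonincreasing_seq gamma)
  (gamma01 : forall m, 0 <= gamma m <= 1).

(** A higher state has a smaller chance of a reset to 0, where the function is largest, and
    otherwise climbs to a higher state, where it is smaller. *)
Lemma nonincreasing_iter_hoc_step n u :
  nonincreasing_seq u -> nonincreasing_seq (iter n Q u).
Proof.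
move=> u_mono; elim: n => //= n; set v := iter n Q u => v_mono.
apply/nonincreasing_seqP => m; rewrite /hoc_step.
have /andP[_ g1] := gamma01 m.+1.
have g_le : gamma m.+1 <= gamma m by apply: gamma_mono.
have v_le : v m.+2 <= v m.+1 by apply: v_mono.
have v0 : v m.+1 <= v 0%N by apply: v_mono.
nra.
Qed.

(** With [v] the [n]-th iterate, the next value at 0 is an average of [v 1] and [v 0], and
    [v 1 <= v 0] by monotonicity in the state. *)
Lemma nonincreasing_return :
  nonincreasing_seq (fun n => iter n Q \1_[set 0%N] 0%N).
Proof.
apply/nonincreasing_seqP => n /=.
have v_mono : nonincreasing_seq (iter n Q \1_[set 0%N]).
  apply: nonincreasing_iter_hoc_step; apply/nonincreasing_seqP => m.
  by rewrite !indicE memNset //; case: (_ \in _).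
have /andP[g0 g1] := gamma01 0%N.
have := v_mono 0%N 1%N isT; rewrite /hoc_step; nra.
Qed.

End ReturnProbabilities.

(** * Comparison of block probabilities for two pasts *)

Section BlockProbabilities.
Context {R : realType} {A : finType}.
Variables (p : A -> history A -> R) (gamma : nat -> R).

(** Histories run backwards in time: the last symbol of the block sits at index 0 and the first at
    index [k]. *)
Definition block (k : nat) (a : 'I_k.+1 -> A) : set (history A) :=
  [set h | forall i : 'I_k.+1, h (k - i)%N = a i].

(** Membership reads only the indices up to [k]; with fewer agreements the trivial bound 1 is
    used. *)
Lemma oscillation_le_block k (a : 'I_k.+1 -> A) :
  oscillation_le (\1_(block a) : history A -> R) \1_(`I_k.+1).
Proof.
move=> m x y xy; rewrite indic_itv !indicE; case: ltnP => km.
  by do 2?case: (_ \in _); rewrite /=; lra.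
suff -> : (x \in block a) = (y \in block a) by rewrite subrr.
apply/idP/idP; rewrite !inE => h i; rewrite -h.
  by rewrite xy // (leq_ltn_trans (leq_subr _ _)).
by rewrite xy // (leq_ltn_trans (leq_subr _ _)).
Qed.

Lemma block_eventE (d : measure_display) (Omega : measurableType d)
    (Z : int -> Omega -> A) k n (a : 'I_k.+1 -> A) :
  [set w | forall i : 'I_k.+1, Z (n + i)%N%:Z w = a i] =
  [set w | block a (history_at Z (n + k.+1) w)].
Proof.
(* The block is read from time [n + k.+1], just after its last symbol. *)
have E (i : 'I_k.+1) : (n + i)%N%:Z = (n + k.+1)%N%:Z - (k - i).+1%:Z :> int.
  by have := ltn_ord i; lia.
by apply/seteqP; split => w /= H i; rewrite -H /history_at E.
Qed.

Lemma prob_block (d : measure_display) (Omega : measurableType d)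
    (Pr : probability Omega R) (x : history A) (Z : int -> Omega -> A)
    k n (a : 'I_k.+1 -> A) :
  chain_with_past Pr p x Z ->
  prob Pr [set w | forall i : 'I_k.+1, Z (n + i)%N%:Z w = a i] =
  iter (n + k.+1) (step p) \1_(block a) x.
Proof.
move=> ZP; rewrite block_eventE; apply: (prob_history_at ZP).
rewrite -block_eventE.
have -> : [set w | forall i : 'I_k.+1, Z (n + i)%N%:Z w = a i] =
    \bigcap_(i in [set: 'I_k.+1]) [set w | Z (n + i)%N%:Z w = a i].
  by apply/seteqP; split=> w /= H i; [move=> _|]; apply: H.
by apply: fin_bigcap_measurable => // i _; apply: (chain_rv ZP).
Qed.

Hypotheses (gamma_le1 : forall m, gamma m <= 1)
  (p_trans : transition_probabilities p) (p_ratio : ratio_condition p gamma).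

Lemma prob_block_dist (x y : history A)
    (dx : measure_display) (Omegax : measurableType dx)
    (Prx : probability Omegax R) (Zx : int -> Omegax -> A)
    (dy : measure_display) (Omegay : measurableType dy)
    (Pry : probability Omegay R) (Zy : int -> Omegay -> A)
    k n (a : 'I_k.+1 -> A) :
  chain_with_past Prx p x Zx -> chain_with_past Pry p y Zy ->
  `|prob Prx [set w | forall i : 'I_k.+1, Zx (n + i)%N%:Z w = a i]
    - prob Pry [set w | forall i : 'I_k.+1, Zy (n + i)%N%:Z w = a i]|
  <= \sum_(j < k.+1) \prod_(0 <= m < j) (1 - gamma m)
       * iter (n + (k.+1 - j)) (hoc_step gamma) \1_[set 0%N] 0%N.
Proof.
move=> ZxP ZyP; rewrite (prob_block n a ZxP) (prob_block n a ZyP).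
have osc := oscillation_le_iter_step gamma_le1 p_trans p_ratio (n + k.+1)
  (@oscillation_le_block k a).
(* The sum decomposes the event that the house-of-cards chain is at height at most [k] at time
   [n + k.+1], according to that height [j]. *)
have -> : \sum_(j < k.+1) \prod_(0 <= m < j) (1 - gamma m)
       * iter (n + (k.+1 - j)) (hoc_step gamma) \1_[set 0%N] 0%N
     = iter (n + k.+1) (hoc_step gamma) \1_(`I_k.+1) 0%N.
  rewrite iter_hoc_step_itv; apply: eq_bigr => j _.
  by rewrite -iter_hoc_step_set1 -addnA subnK // ltnW.
(* Index 0, because [x] and [y] need not agree anywhere; both orders of the pair give the absolute
   value. *)
by rewrite ler_norml lerNl opprB !(osc 0%N).
Qed.

End BlockProbabilities.

Theorem corollary1 (R : realType) (A : finType)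
  (p : A -> history A -> R) (gamma : nat -> R)
  (p_trans : transition_probabilities p)
  (gamma_mono : nonincreasing_seq gamma)
  (gamma_cvg : gamma @ \oo --> (0 : R))
  (gamma0_lt1 : gamma 0%N < 1)
  (p_ratio : ratio_condition p gamma)
  (dS : measure_display) (OmegaS : measurableType dS)
  (PrS : probability OmegaS R) (S : nat -> OmegaS -> nat)
  (S_markov : markov_chain PrS (house_of_cards gamma) 0%N S)
  (x y : history A)
  (dx : measure_display) (Omegax : measurableType dx)
  (Prx : probability Omegax R) (Zx : int -> Omegax -> A)
  (Zx_chain : chain_with_past Prx p x Zx)
  (dy : measure_display) (Omegay : measurableType dy)
  (Pry : probability Omegay R) (Zy : int -> Omegay -> A)
  (Zy_chain : chain_with_past Pry p y Zy) :
  let gamma_star (n : nat) : R := prob PrS [set w | S n w = 0%N] in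
  (forall (a : A) (n : nat),
     `|prob Prx [set w | Zx n%:Z w = a] - prob Pry [set w | Zy n%:Z w = a]|
       <= gamma_star n)
  /\
  (forall (k n : nat) (a : 'I_k.+1 -> A), (1 <= k)%N -> (k <= n)%N ->
     `|prob Prx [set w | forall i : 'I_k.+1, Zx (n + i)%N%:Z w = a i]
       - prob Pry [set w | forall i : 'I_k.+1, Zy (n + i)%N%:Z w = a i]|
       <= \sum_(j < k.+1)
            (\prod_(1 <= m < j) (1 - gamma m)) * gamma_star (n - j)%N).
Proof.
move=> gamma_star.
have gamma01 m : 0 <= gamma m <= 1.
  apply/andP; split; last exact: le_trans (gamma_mono 0%N m _) (ltW gamma0_lt1).
  (* A nonincreasing sequence stays above its limit, here 0. *)
  rewrite -(cvg_lim (@Rhausdorff R) gamma_cvg).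
  by apply: nonincreasing_cvgn_ge => //; apply: cvgP gamma_cvg.
have gamma_le1 m : gamma m <= 1 by case/andP: (gamma01 m).
have gsE n : iter n (hoc_step gamma) \1_[set 0%N] 0%N = gamma_star n.
  by rewrite -(prob_markov_at S_markov).
have gs_le m n : (m <= n)%N -> gamma_star n <= gamma_star m.
  by rewrite -!gsE; apply: nonincreasing_return.
split=> [a n|k n a _ k_n].
  (* A single symbol is a block with [k = 0]; this gives [gamma_star (n + 1)], which is at most
     [gamma_star n]. *)
  have := prob_block_dist gamma_le1 p_trans p_ratio n (fun _ : 'I_1 => a)
    Zx_chain Zy_chain.
  have E T (Z : int -> T -> A) :
      [set w | forall i : 'I_1, Z (n + i)%N%:Z w = a] = [set w | Z n%:Z w = a].
    apply/seteqP; split => w /= H; first by have := H ord0; rewrite addn0.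
    by move=> i; rewrite ord1 addn0.
  rewrite !E big_ord_recl big_ord0 big_geq // mul1r addr0 gsE => /le_trans; apply.
  by apply: gs_le; rewrite leq_addr.
apply: le_trans (prob_block_dist gamma_le1 p_trans p_ratio n a Zx_chain Zy_chain) _.
apply: ler_sum => j _; rewrite gsE.
have prod_ge0 b c : 0 <= \prod_(b <= m < c) (1 - gamma m).
  by apply: prodr_ge0 => m _; rewrite subr_ge0.
apply: ler_pM => //; first exact: prob_ge0.
  (* For [j = 0] both products are empty; otherwise they differ by the factor [1 - gamma 0], which
     is at most 1. *)
  case: (nat_of_ord j) => [|i]; first by rewrite !big_geq.
  rewrite big_ltn // ler_piMl // lerBlDr lerDl; by case/andP: (gamma01 0%N).
by apply: gs_le; lia.
Qed.
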